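(* Let $Q$ be a topological groupoid on a topological space $X$ with a path connection $\Gamma$. Let $\mathcal{U}=\{U_i : i\in I\}$ be an open cover of $X$ and for each $i\in I$ let $geod(U_i)$ be a collection of paths in $U_i$ (an element $\lambda\in geod(U_i)$ with $\lambda(0)=x$, $\lambda(1)=y$ being called a geodesic path from $x$ to $y$). Suppose that: (i) if $x,y\in U_i$, then there is a unique geodesic path $geod_i(x,y)\in geod(U_i)$ from $x$ to $y$; (ii) if $x,y\in U_i\cap U_j$, then $geod_i(x,y)=geod_j(x,y)$; (iii) (flatness) if $\lambda$ is any path in $U_i$ from $x$ to $y$, then $\Gamma(\lambda)(1)=\Gamma(geod_i(x,y))(1)$. Then there is a local subgroupoid $c_{\Gamma}(Q,\mathcal{U})$ of $Q$ well defined by $c_{\Gamma}(Q,\mathcal{U})(x)=[U_i,C_{\Gamma}(Q|U_i)]_x$ for $x\in U_i$.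
   Context: A groupoid $Q$ on $X$ has object set $X$, source $\alpha$ and target $\beta$; $gh$ (also written $g\circ h$) is defined iff $\beta(g)=\alpha(h)$. A topological groupoid on $X$ has topologies on its set of arrows and on its object space $X$ making all structure maps continuous. A subgroupoid is wide if it has all objects. For $U\subseteq X$, $Q|U$ is the full subgroupoid on $U$ (and similarly $H|W$ for a subgroupoid $H$). $\Lambda(Y)$ denotes the space of paths $[0,1]\to Y$ in a topological space $Y$. A path connection in $Q$ is a continuous map $\Gamma:\Lambda(X)\to\Lambda(Q)$ such that (1) $\alpha(\Gamma(\lambda)(t))=\lambda(0)$ and $\beta(\Gamma(\lambda)(t))=\lambda(t)$ for $t\in[0,1]$; (2) (transport condition) if $\psi:[0,1]\to[t_0,t_1]\subseteq[0,1]$ is a homeomorphism then $\Gamma(\lambda)(\psi(t))=\Gamma(\lambda)(\psi(0))\circ\Gamma(\lambda\psi)(t)$ for all $t\in[0,1]$. $C_\Gamma(Q)$ is the set of $g\in Q$ such that there is a path $\lambda$ in $X$ with $\Gamma(\lambda)(0)=1_{\alpha(g)}$ and $\Gamma(\lambda)(1)=g$; it is a wide subgroupoid of $Q$. For $U$ open in $X$, $C_\Gamma(Q|U)$ is defined in the same way using paths $\lambda$ in $U$ (for which $\Gamma(\lambda)$ lies in $Q|U$). Local subgroupoids: for $x\in X$, consider pairs $(U,H)$ with $U$ an open neighbourhood of $x$ and $H$ a wide subgroupoid of $Q|U$. Pairs $(U,H)$, $(V,K)$ have the same germ at $x$, $[U,H]_x=[V,K]_x$, iff $H|W=K|W$ for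 some open $W$ with $x\in W\subseteq U\cap V$. A local subgroupoid $s$ of $Q$ assigns to each $x\in X$ a germ $s(x)$ at $x$ such that each point of $X$ has an open neighbourhood $U$ and a wide subgroupoid $H$ of $Q|U$ with $s(y)=[U,H]_y$ for all $y\in U$ (equivalently, a continuous global section of the sheaf associated to the presheaf $U\mapsto\{\text{wide subgroupoids of } Q|U\}$). *)

(* Defs.v *)
From HB Require Import structures.
From mathcomp Require Import all_boot all_order all_algebra.
From mathcomp Require Import all_classical all_reals all_analysis.

Set Implicit Arguments.
Unset Strict Implicit.
Unset Printing Implicit Defensive.

Import Order.TTheory GRing.Theory Num.Theory.
Import numFieldNormedType.Exports.

Local Open Scope classical_set_scope.
Local Open Scope ring_scope.

(* The product [gcomp g h] is in diagrammatic order and is only meaningful when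
   [tgt g = src h]: elsewhere its value is arbitrary, and no axiom (nor the
   continuity requirement, which is for the subspace topology on composable
   pairs) constrains it. *)
Record topGroupoid (X : topologicalType) := TopGroupoid {
  arrow :> topologicalType;
  src : arrow -> X;
  tgt : arrow -> X;
  gid : X -> arrow;
  ginv : arrow -> arrow;
  gcomp : arrow -> arrow -> arrow;
  src_gid : forall x, src (gid x) = x;
  tgt_gid : forall x, tgt (gid x) = x;
  src_ginv : forall g, src (ginv g) = tgt g;
  tgt_ginv : forall g, tgt (ginv g) = src g;
  src_gcomp : forall g h, tgt g = src h -> src (gcomp g h) = src g;
  tgt_gcomp : forall g h, tgt g = src h -> tgt (gcomp g h) = tgt h;
  gcompA : forall g h k, tgt g = src h -> tgt h = src k ->
    gcomp g (gcomp h k) = gcomp (gcomp g h) k;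
  gcomp1g : forall g, gcomp (gid (src g)) g = g;
  gcompg1 : forall g, gcomp g (gid (tgt g)) = g;
  gcompVg : forall g, gcomp (ginv g) g = gid (tgt g);
  gcompgV : forall g, gcomp g (ginv g) = gid (src g);
  src_continuous : continuous src;
  tgt_continuous : continuous tgt;
  gid_continuous : continuous gid;
  ginv_continuous : continuous ginv;
  gcomp_continuous :
    {within [set p : arrow * arrow | tgt p.1 = src p.2],
      continuous (fun p => gcomp p.1 p.2)}
}.

Definition unitI (R : realType) : topologicalType :=
  set_type (`[0, 1]%classic : set R).

Lemma unitI0_subproof (R : realType) : (0 : R) \in (`[0, 1]%classic : set R).
Proof. by rewrite inE /= in_itv /= lexx ler01. Qed.

Lemma unitI1_subproof (R : realType) : (1 : R) \in (`[0, 1]%classic : set R).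
Proof. by rewrite inE /= in_itv /= lexx ler01. Qed.

Definition unitI0 {R : realType} : unitI R := exist _ 0 (unitI0_subproof R).
Definition unitI1 {R : realType} : unitI R := exist _ 1 (unitI1_subproof R).

Definition pathSpace (R : realType) (Y : topologicalType) :=
  continuousType (unitI R) Y.

(* The path space carries the compact-open topology. *)
HB.instance Definition _ (R : realType) (Y : topologicalType) :=
  Topological.copy (pathSpace R Y)
    (@initial_topology (continuousType (unitI R) Y)
      {compact-open, unitI R -> Y} id).

Definition path_in (R : realType) (Y : topologicalType) (U : set Y)
  (l : pathSpace R Y) := forall t, U (l t).

Definition subI (R : realType) (t0 t1 : unitI R) : set (unitI R) :=
  [set t | sval t0 <= sval t <= sval t1].

Definition homeomorphism_onto (S T : topologicalType) (f : S -> T)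
    (A : set T) :=
  [/\ continuous f, forall s, A (f s) &
    exists g : T -> S, [/\ {within A, continuous g},
      forall s, g (f s) = s & forall t, A t -> f (g t) = t]].

Record pathConnection (R : realType) (X : topologicalType)
    (Q : topGroupoid X) := PathConnection {
  pconn :> pathSpace R X -> pathSpace R Q;
  pconn_continuous : continuous pconn;
  src_pconn : forall (l : pathSpace R X) t, src (pconn l t) = l unitI0;
  tgt_pconn : forall (l : pathSpace R X) t, tgt (pconn l t) = l t;
  pconn_transport : forall (l : pathSpace R X) (t0 t1 : unitI R)
      (psi : pathSpace R (unitI R)),
    homeomorphism_onto psi (subI t0 t1) ->
    forall t, pconn l (psi t) =
      gcomp (pconn l (psi unitI0)) (pconn (l \o psi) t)
}.

Section Subgroupoids.
Context (X : topologicalType) (Q : topGroupoid X).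
Implicit Types (U V W : set X) (H K : set Q).

(* [grestrict Q W H] is the full subgroupoid H|W; Q|W is
   [grestrict W setT]. *)
Definition grestrict W H : set Q := [set g | [/\ H g, W (src g) & W (tgt g)]].

Definition wide_subgroupoid U H :=
  [/\ H `<=` grestrict U setT,
      forall x, U x -> H (gid Q x),
      forall g, H g -> H (ginv g) &
      forall g h, H g -> H h -> tgt g = src h -> H (gcomp g h)].

Definition local_pair (x : X) (p : set X * set Q) :=
  [/\ open p.1, p.1 x & wide_subgroupoid p.1 p.2].

Definition same_germ (x : X) (p q : set X * set Q) :=
  exists W, [/\ open W, W x, W `<=` p.1 `&` q.1 &
    grestrict W p.2 = grestrict W q.2].

(* The germ [U, H]_x as an equivalence class of pairs; it is meant to be used
   when [local_pair x (U, H)] holds. *)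
Definition germ U H (x : X) : set (set X * set Q) :=
  [set q | local_pair x q /\ same_germ x (U, H) q].

Record localSubgroupoid := LocalSubgroupoid {
  lsg_germ :> X -> set (set X * set Q);
  lsg_local : forall x, exists U H,
    [/\ open U, U x, wide_subgroupoid U H &
      forall y, U y -> lsg_germ y = germ U H y]
}.

End Subgroupoids.

(* C_Gamma(Q|U); the case [U = setT] is C_Gamma(Q). *)
Definition pconn_subgroupoid (R : realType) (X : topologicalType)
    (Q : topGroupoid X) (Gamma : pathConnection R Q) (U : set X) : set Q :=
  [set g | grestrict U setT g /\ exists l : pathSpace R X,
    [/\ path_in U l, Gamma l unitI0 = gid Q (src g) & Gamma l unitI1 = g]].

Definition path_from_to (R : realType) (X : topologicalType) (x y : X)
  (l : pathSpace R X) := l unitI0 = x /\ l unitI1 = y.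

(* [geodesic geod i x y l] says that l is a geodesic path geod_i(x, y). *)
Definition geodesic (R : realType) (X : topologicalType) (I : Type)
    (geod : I -> set (pathSpace R X)) (i : I) (x y : X) (l : pathSpace R X) :=
  geod i l /\ path_from_to x y l.

(* Main.v *)
Require Import Defs.
From mathcomp Require Import all_boot all_order all_algebra.
From mathcomp Require Import all_classical all_reals all_analysis.
From mathcomp Require Import lra.

Set Implicit Arguments.
Unset Strict Implicit.
Unset Printing Implicit Defensive.

Import Order.TTheory GRing.Theory Num.Theory.
Import numFieldNormedType.Exports.

Local Open Scope classical_set_scope.

(** The existence of geodesics and flatness serve only to compare the groupoids
    [pconn_subgroupoid Gamma (U i)] on overlaps; that each of them is a wide
    subgroupoid is a consequence of the transport condition alone.

    Applied to the affine bijection of [0, 1] onto the segment from a to b,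
    with a and b distinct, the transport condition at time 1 reads
      Gamma l b = Gamma l a o Gamma (l restricted to [a, b]) 1
    ([pconn_segment]).  The segment may be traversed backwards, since
    homeomorphisms are not required to be increasing.  The rest follows from
    this by cancelling in the groupoid:
    - the segment from 0 to 1 gives that Gamma l 0 is an identity;
    - the segment from 1 to 0 gives that the reversed path lifts to the inverse;
    - the two halves of a concatenation give that it lifts to the product;
    - the two halves of a constant path, which are the same constant path,
      give that it lifts to an identity.
    So the endpoints of the lifts of paths in U are closed under the groupoid
    operations ([pconn_subgroupoid_wide]).

    On an overlap of U i and U j, an arrow from x to y which is the endpoint of
    the lift of some path in U i is, by flatness, the endpoint of the lift of
    the geodesic of U i from x to y.  This is also the geodesic of U j, so it
    lies in U j, and the arrow belongs to the groupoid of U j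
    ([pconn_subgroupoid_overlap]).  Hence the groupoids of U i and U j have the
    same restriction to the overlap, and compatible wide subgroupoids on an open
    cover glue to a unique local subgroupoid ([glue_wide_subgroupoids]). *)

(** * Affine segments and concatenation of paths *)

Section UnitInterval.
Local Open Scope ring_scope.
Context (R : realType).
Implicit Types (s t a b : unitI R) (r : R).

Lemma unitI_ge0 t : 0 <= sval t.
Proof. by case: t => t /=; rewrite inE /= in_itv /= => /andP[]. Qed.

Lemma unitI_le1 t : sval t <= 1.
Proof. by case: t => t /=; rewrite inE /= in_itv /= => /andP[]. Qed.

Lemma unitI_inj s t : sval s = sval t -> s = t.
Proof. exact: val_inj. Qed.

Lemma sval_continuous : continuous (fun t : unitI R => sval t).
Proof. exact: initial_continuous. Qed.

Definition clip r : R := Num.max 0 (Num.min 1 r).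

Lemma clip_subproof r : clip r \in (`[0, 1]%classic : set R).
Proof.
by rewrite inE /= in_itv /= le_max lexx ge_max ler01 ge_min lexx.
Qed.

(** The retraction of the line onto [0, 1]: maps into [unitI R] can be given by
    real formulas, and are then continuous as soon as the formula is. *)
Definition toI r : unitI R := exist _ (clip r) (clip_subproof r).

Lemma toI_val r : 0 <= r <= 1 -> sval (toI r) = r.
Proof. by move=> /andP[r0 r1] /=; rewrite /clip min_r // max_r. Qed.

Lemma toIK t : toI (sval t) = t.
Proof. by apply/unitI_inj/toI_val; rewrite unitI_ge0 unitI_le1. Qed.

Lemma toI_continuous : continuous toI.
Proof.
apply: continuous_comp_initial => r /=.
apply: (@continuous_max _ _ (cst 0) _ r); first exact: cvg_cst.
apply: (@continuous_min _ _ (cst 1) _ r); first exact: cvg_cst.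
exact: cvg_id.
Qed.

Definition toI_affine (c k : R) t : unitI R := toI (c + k * sval t).

Lemma toI_affine_continuous (c k : R) : continuous (toI_affine c k).
Proof.
have affine : continuous (fun r : R => c + k * r).
  move=> r; apply: cvgD; first exact: cvg_cst.
  exact: mulrl_continuous.
move=> t; apply: (@continuous_comp _ R _ (fun s : unitI R => sval s)
  (fun r => toI (c + k * r))); first exact: sval_continuous.
by apply: continuous_comp; [exact: affine | exact: toI_continuous].
Qed.

Definition segment a b : pathSpace R (unitI R) :=
  mkcts (@toI_affine_continuous (sval a) (sval b - sval a)).

Lemma segment_val a b t :
  sval (segment a b t) = sval a + (sval b - sval a) * sval t.
Proof.
apply: toI_val.
have := (unitI_ge0 a, unitI_ge0 b, unitI_ge0 t).
have := (unitI_le1 a, unitI_le1 b, unitI_le1 t).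
move=> [[a1 b1] t1] [[a0 b0] t0]; apply/andP; split; nra.
Qed.

Lemma segment0 a b : segment a b unitI0 = a.
Proof. by apply: unitI_inj; rewrite segment_val mulr0 addr0. Qed.

Lemma segment1 a b : segment a b unitI1 = b.
Proof. by apply: unitI_inj; rewrite segment_val mulr1 addrC subrK. Qed.

Lemma segment01 t : segment unitI0 unitI1 t = t.
Proof. by apply: unitI_inj; rewrite segment_val subr0 mul1r add0r. Qed.

Lemma segment_homeomorphism a b t0 t1 : sval a != sval b ->
  sval t0 = Num.min (sval a) (sval b) -> sval t1 = Num.max (sval a) (sval b) ->
  homeomorphism_onto (segment a b) (subI t0 t1).
Proof.
move=> ab mab Mab; split; first exact: toI_affine_continuous.
  move=> s; rewrite /subI /mkset segment_val mab Mab.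
  have := (unitI_ge0 s, unitI_le1 s).
  by case: (leP (sval a) (sval b)) => h [s0 s1]; apply/andP; split; nra.
have ba0 : sval b - sval a != 0 by rewrite subr_eq0 eq_sym.
set k := (sval b - sval a)^-1.
exists (toI_affine (- (k * sval a)) k).
have affineE s : - (k * sval a) + k * sval s = k * (sval s - sval a).
  by rewrite addrC -mulrBr.
split.
- exact/continuous_subspaceT/toI_affine_continuous.
- move=> s; rewrite /toI_affine affineE segment_val (addrC (sval a)) addrK.
  by rewrite mulKf // toIK.
- move=> t; rewrite /subI /= mab Mab => tab.
  apply: unitI_inj; rewrite segment_val /toI_affine affineE toI_val.
    by rewrite mulVKf // subrKC.
  have kE : k * (sval b - sval a) = 1 by rewrite mulVf.
  have [k_ge0 k_le] : 0 <= k * (sval t - sval a) /\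
      k * (sval t - sval a) <= k * (sval b - sval a).
    move: tab; case: (ltgtP (sval a) (sval b)) ab => //
      [ab_lt|ba_lt] _ /andP[t_ge t_le].
      have k0 : 0 < k by rewrite /k invr_gt0 subr_gt0.
      by rewrite ler_pM2l // mulr_ge0 ?subr_ge0 ?lerB // ltW.
    have k0 : k < 0 by rewrite /k invr_lt0 subr_lt0.
    by rewrite ler_nM2l // mulr_le0 ?subr_le0 ?lerB // ltW.
  by rewrite k_ge0 (le_trans k_le) ?kE.
Qed.

Definition unitI_half : unitI R := toI 2^-1.

Lemma unitI_half_val : sval unitI_half = 2^-1.
Proof. by apply: toI_val; lra. Qed.

Lemma half_neq0 : sval (unitI0 : unitI R) != sval unitI_half.
Proof. by rewrite unitI_half_val /= eq_sym invr_neq0 ?pnatr_eq0. Qed.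

Lemma half_neq1 : sval unitI_half != sval (unitI1 : unitI R).
Proof. by rewrite unitI_half_val /= lt_eqF // invf_lt1 ?ltr1n ?ltr0n. Qed.

Lemma segment_left t : sval (segment unitI0 unitI_half t) <= 2^-1 /\
  toI_affine 0 2 (segment unitI0 unitI_half t) = t.
Proof.
rewrite /toI_affine segment_val unitI_half_val /=; have := unitI_le1 t.
by split; [lra | rewrite -[RHS]toIK; congr toI; lra].
Qed.

Lemma segment_right t : 2^-1 <= sval (segment unitI_half unitI1 t) /\
  toI_affine (-1) 2 (segment unitI_half unitI1 t) = t.
Proof.
rewrite /toI_affine segment_val unitI_half_val /=; have := unitI_ge0 t.
by split; [lra | rewrite -[RHS]toIK; congr toI; lra].
Qed.

End UnitInterval.

Section Concatenation.
Local Open Scope ring_scope.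
Context (R : realType) (X : topologicalType).
Implicit Types (l m : pathSpace R X) (t : unitI R).

Lemma pathP l m : l =1 m -> l = m.
Proof. by move=> lm; apply/continuousEP. Qed.

Lemma subpath0 l (a b : unitI R) :
  (l \o segment a b : pathSpace R X) unitI0 = l a.
Proof. by rewrite -[LHS]/(l (segment a b unitI0)) segment0. Qed.

Definition concat_fun l m t : X :=
  if sval t <= 2^-1 then l (toI_affine 0 2 t) else
  m (toI_affine (-1) 2 t).

Lemma concat_half l m t : l unitI1 = m unitI0 -> sval t = 2^-1 ->
  l (toI_affine 0 2 t) = m (toI_affine (-1) 2 t).
Proof.
move=> lm; rewrite /toI_affine => ->.
by rewrite add0r divff ?pnatr_eq0 // addNr (toIK unitI1) (toIK unitI0).
Qed.

Lemma concat_continuous l m :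
  l unitI1 = m unitI0 -> continuous (concat_fun l m).
Proof.
move=> lm.
pose f t := l (toI_affine 0 2 t).
pose g t := m (toI_affine (-1) 2 t).
have cf : continuous f.
  move=> t; apply: continuous_comp; last exact: cts_fun.
  exact: toI_affine_continuous.
have cg : continuous g.
  move=> t; apply: continuous_comp; last exact: cts_fun.
  exact: toI_affine_continuous.
(* The preimage of a closed set is the union of its traces on the two closed
   halves of the interval, where the function is f and g respectively. *)
apply/continuous_closedP => C cC.
pose h1 := [set t : unitI R | sval t <= 2^-1].
pose h2 := [set t : unitI R | 2^-1 <= sval t].
have -> : concat_fun l m @^-1` C = (h1 `&` f @^-1` C) `|` (h2 `&` g @^-1` C).
  apply/seteqP; split => t; rewrite /concat_fun /h1 /h2 /=.
    by case: leP => t2 Ct; [left | right; split => //; exact: ltW].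
  case: leP => t2 [] [] // t2' Ct.
  by rewrite (concat_half lm) //; apply/le_anti/andP.
have cval := proj1 (continuous_closedP _) (@sval_continuous R).
apply: closedU; apply: closedI.
- by apply: (cval _ (@closed_le R 2^-1)).
- by move/continuous_closedP: cf; apply.
- by apply: (cval _ (@closed_ge R 2^-1)).
- by move/continuous_closedP: cg; apply.
Qed.

Definition concat l m (lm : l unitI1 = m unitI0) : pathSpace R X :=
  mkcts (concat_continuous lm).

Lemma concat_left l m (lm : l unitI1 = m unitI0) :
  concat lm \o segment unitI0 (unitI_half R) = l :> pathSpace R X.
Proof.
apply: pathP => t.
rewrite -[LHS]/(concat_fun l m (segment unitI0 (unitI_half R) t)).
by have [t_le tE] := segment_left t; rewrite /concat_fun t_le tE.
Qed.

Lemma concat_right l m (lm : l unitI1 = m unitI0) :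
  concat lm \o segment (unitI_half R) unitI1 = m :> pathSpace R X.
Proof.
apply: pathP => t.
rewrite -[LHS]/(concat_fun l m (segment (unitI_half R) unitI1 t)).
have [t_ge tE] := segment_right t; rewrite /concat_fun.
case: ifPn => [t_le|_]; last by rewrite tE.
by rewrite (concat_half lm) ?tE //; apply/le_anti/andP.
Qed.

Lemma path_in_concat (U : set X) l m (lm : l unitI1 = m unitI0) :
  path_in U l -> path_in U m -> path_in U (concat lm).
Proof.
move=> Ul Um t; rewrite -[concat lm t]/(concat_fun l m t) /concat_fun.
by case: ifP.
Qed.

End Concatenation.

(** * Lifts of paths along a path connection *)

Section Groupoid.
Context (X : topologicalType) (Q : topGroupoid X).
Implicit Types (g h : Q) (x : X).

Lemma gcomp_eqr g h : tgt g = src h -> gcomp g h = h -> g = gid Q (src g).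
Proof.
move=> gh e; rewrite -{1}(gcompg1 g) gh -(gcompgV h) gcompA ?src_ginv // e.
by rewrite gcompgV -(src_gcomp gh) e.
Qed.

Lemma gcomp_eq1 g h x : tgt g = src h -> gcomp g h = gid Q x -> h = ginv g.
Proof.
move=> gh e.
have xE : x = tgt h by rewrite -(tgt_gid Q x) -e tgt_gcomp.
have xE' : x = src g by rewrite -(src_gid Q x) -e src_gcomp.
rewrite -(gcomp1g h) -gh -gcompVg -gcompA ?tgt_ginv // e xE' -tgt_ginv.
by rewrite gcompg1.
Qed.

End Groupoid.

Section PathConnection.
Context (R : realType) (X : topologicalType) (Q : topGroupoid X)
  (Gamma : pathConnection R Q).
Implicit Types (l m : pathSpace R X) (a b : unitI R).

(** This is the only form in which the transport condition is used.  It covers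
    both orders of a and b: the inverse of an arrow comes from running a path
    backwards. *)
Lemma pconn_segment l a b : sval a != sval b ->
  Gamma l b = gcomp (Gamma l a) (Gamma (l \o segment a b) unitI1).
Proof.
move=> ab.
have [t0 [t1 [t0E t1E]]] : exists t0 t1 : unitI R,
    sval t0 = Num.min (sval a) (sval b) /\ sval t1 = Num.max (sval a) (sval b).
  by case: (leP (sval a) (sval b)) => _; [exists a, b | exists b, a].
have := pconn_transport Gamma l (segment_homeomorphism ab t0E t1E) unitI1.
by rewrite segment0 segment1.
Qed.

Lemma pconn0 l : Gamma l unitI0 = gid Q (l unitI0).
Proof.
have /esym := @pconn_segment l unitI0 unitI1 (negbT (lt_eqF ltr01)).
have -> : l \o segment unitI0 unitI1 = l :> pathSpace R X.
  by apply: pathP => t /=; rewrite segment01.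
by move/gcomp_eqr; rewrite !(src_pconn, tgt_pconn); apply.
Qed.

(** Both halves of the constant path are the constant path itself, so its lift
    at time 1 is also its lift g at time 1/2, and g o g = g.  Continuity of the
    lift would not do, as the space of arrows need not be separated. *)
Lemma pconn_cst (x : X) : Gamma (cst x : pathSpace R X) unitI1 = gid Q x.
Proof.
set c : pathSpace R X := cst x.
have cE a b : c \o segment a b = c :> pathSpace R X by exact: pathP.
have e1 := pconn_segment c (half_neq0 R).
have /esym e2 := pconn_segment c (half_neq1 R).
rewrite !cE in e1 e2.
have := @gcomp_eqr _ _ _ _ _ e2.
rewrite !(src_pconn, tgt_pconn) => /(_ erefl) e3.
rewrite e1 pconn0 in e3.
by have := gcomp1g (Gamma c unitI1); rewrite src_pconn e3 => <-.
Qed.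

Lemma pconn_reverse l :
  Gamma (l \o segment unitI1 unitI0) unitI1 = ginv (Gamma l unitI1).
Proof.
have e := @pconn_segment l unitI1 unitI0 (negbT (gt_eqF ltr01)).
rewrite pconn0 in e; apply: gcomp_eq1 (esym e).
by rewrite tgt_pconn src_pconn subpath0.
Qed.

Lemma pconn_concat l m (lm : l unitI1 = m unitI0) :
  Gamma (concat lm) unitI1 = gcomp (Gamma l unitI1) (Gamma m unitI1).
Proof.
rewrite (pconn_segment _ (half_neq1 R)) concat_right.
rewrite (pconn_segment _ (half_neq0 R)) concat_left.
have l0 : concat lm unitI0 = l unitI0.
  by rewrite -[in RHS](concat_left lm) subpath0.
by rewrite pconn0 l0 -(src_pconn Gamma l unitI1) gcomp1g.
Qed.

Lemma pconn_subgroupoidP (U : set X) (g : Q) :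
  pconn_subgroupoid Gamma U g <->
  exists2 l : pathSpace R X, path_in U l & Gamma l unitI1 = g.
Proof.
split=> [[_ [l [Ul _ lg]]]|[l Ul <-]]; first by exists l.
split; first by split; rewrite // ?src_pconn ?tgt_pconn.
by exists l; rewrite pconn0 src_pconn.
Qed.

Lemma pconn_subgroupoid_wide (U : set X) :
  wide_subgroupoid U (pconn_subgroupoid Gamma U).
Proof.
split=> [g []//|x Ux|g /pconn_subgroupoidP[l Ul <-]|].
- by apply/pconn_subgroupoidP; exists (cst x); [|exact: pconn_cst].
- apply/pconn_subgroupoidP; exists (l \o segment unitI1 unitI0).
    by move=> t; exact: Ul.
  exact: pconn_reverse.
- move=> g h /pconn_subgroupoidP[l Ul <-] /pconn_subgroupoidP[m Um <-].
  rewrite tgt_pconn src_pconn => lm; apply/pconn_subgroupoidP.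
  by exists (concat lm); [exact: path_in_concat | exact: pconn_concat].
Qed.

(** Flatness allows the path whose lift defines an arrow over the overlap to be
    replaced by the geodesic, which lies in both U i and U j. *)
Lemma pconn_subgroupoid_overlap (I : Type) (U : I -> set X)
    (geod : I -> set (pathSpace R X))
    (geod_in : forall i l, geod i l -> path_in (U i) l)
    (geod_ex : forall i x y, U i x -> U i y -> exists l, geodesic geod i x y l)
    (geod_compat : forall i j x y, (U i `&` U j) x -> (U i `&` U j) y ->
      forall l m, geodesic geod i x y l -> geodesic geod j x y m -> l = m)
    (flat : forall i x y l m, path_in (U i) l -> path_from_to x y l ->
      geodesic geod i x y m -> Gamma l unitI1 = Gamma m unitI1) (i j : I) :
  grestrict (U i `&` U j) (pconn_subgroupoid Gamma (U i)) `<=`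
  grestrict (U i `&` U j) (pconn_subgroupoid Gamma (U j)).
Proof.
move=> g [/pconn_subgroupoidP[l Ul lg] Wx Wy]; split=> //.
have lxy : path_from_to (src g) (tgt g) l.
  by rewrite -lg src_pconn tgt_pconn.
have [m mi] := geod_ex _ _ _ Wx.1 Wy.1.
have [n nj] := geod_ex _ _ _ Wx.2 Wy.2.
apply/pconn_subgroupoidP; exists n; first exact: geod_in nj.1.
rewrite -(geod_compat _ _ _ _ Wx Wy _ _ mi nj) -lg.
exact/esym/(flat _ _ _ _ _ Ul lxy mi).
Qed.

End PathConnection.

(** * Gluing wide subgroupoids into a local subgroupoid *)

Section Gluing.
Context (X : topologicalType) (Q : topGroupoid X).
Implicit Types (U V W : set X) (H K : set Q) (x : X).

Lemma grestrictI V W H : grestrict V (grestrict W H) = grestrict (V `&` W) H.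
Proof.
by apply/seteqP; split => g [] => [[]|] => [? ? ? ? ?|? [] ? ? []].
Qed.

Lemma same_germ_sym x p q : same_germ (Q := Q) x p q -> same_germ x q p.
Proof. by case=> W [oW Wx Wpq e]; exists W; rewrite setIC. Qed.

Lemma same_germ_trans x p q r :
  same_germ (Q := Q) x p q -> same_germ x q r -> same_germ x p r.
Proof.
move=> [V [oV Vx Vpq eV]] [W [oW Wx Wqr eW]]; exists (V `&` W); split.
- exact: openI.
- by [].
- by move=> y [/Vpq[] py _ /Wqr[]].
- by rewrite [in LHS]setIC -!grestrictI eV -eW !grestrictI setIC.
Qed.

Lemma eq_germ U H V K x :
  same_germ x (U, H) (V, K) -> germ U H x = germ V K x.
Proof.
move=> e; apply/seteqP; split=> q [lq eq]; split=> //.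
  exact: same_germ_trans (same_germ_sym e) eq.
exact: same_germ_trans e eq.
Qed.

Lemma localSubgroupoidP (c d : localSubgroupoid Q) : c =1 d -> c = d.
Proof.
case: c d => [c hc] [d hd] /= /funext cd.
by move: hc; rewrite cd => hc; congr LocalSubgroupoid; exact: Prop_irrelevance.
Qed.

(** Over the whole of U i the germ chosen at each point is the germ of the single
    subgroupoid H i, which is both the local condition on the glued section and
    the equation that determines it. *)
Lemma glue_wide_subgroupoids (I : Type) (U : I -> set X) (H : I -> set Q)
    (U_open : forall i, open (U i)) (U_cover : \bigcup_i U i = [set: X])
    (H_wide : forall i, wide_subgroupoid (U i) (H i))
    (H_overlap : forall i j,
      grestrict (U i `&` U j) (H i) = grestrict (U i `&` U j) (H j)) :
  exists! c : localSubgroupoid Q, forall i x, U i x -> c x = germ (U i) (H i) x.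
Proof.
have coverP x : exists i, U i x.
  by have : [set: X] x by []; rewrite -U_cover => -[i _ Ux]; exists i.
have [ix Uix] := choice coverP.
have germE i j x : U i x -> U j x -> germ (U i) (H i) x = germ (U j) (H j) x.
  move=> Ui Uj; apply: eq_germ; exists (U i `&` U j).
  by split=> //; exact: openI.
pose c x := germ (U (ix x)) (H (ix x)) x.
have c_local x : exists V K, [/\ open V, V x, wide_subgroupoid V K &
    forall y, V y -> c y = germ V K y].
  by exists (U (ix x)), (H (ix x)); split=> // y Uy; exact: germE.
exists (LocalSubgroupoid c_local); split=> [i x Ux /=|d dE]; first exact: germE.
by apply: localSubgroupoidP => x /=; rewrite (dE (ix x)).
Qed.

End Gluing.

Theorem proposition4p3 (R : realType) (X : topologicalType)
    (Q : topGroupoid X) (Gamma : pathConnection R Q)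
    (I : Type) (U : I -> set X) (geod : I -> set (pathSpace R X))
    (U_open : forall i, open (U i))
    (U_cover : \bigcup_i U i = [set: X])
    (geod_in : forall i l, geod i l -> path_in (U i) l)
    (geod_unique : forall i x y, U i x -> U i y ->
      exists! l, geodesic geod i x y l)
    (geod_compat : forall i j x y, (U i `&` U j) x -> (U i `&` U j) y ->
      forall l m, geodesic geod i x y l -> geodesic geod j x y m -> l = m)
    (flat : forall i x y (l m : pathSpace R X),
      path_in (U i) l -> path_from_to x y l -> geodesic geod i x y m ->
      Gamma l unitI1 = Gamma m unitI1) :
  (forall i, wide_subgroupoid (U i) (pconn_subgroupoid Gamma (U i))) /\
  (exists! c : localSubgroupoid Q, forall i x, U i x ->
    c x = germ (U i) (pconn_subgroupoid Gamma (U i)) x).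
Proof.
have wide i := pconn_subgroupoid_wide Gamma (U i).
split=> //; apply: glue_wide_subgroupoids => // i j.
have geod_ex k x y : U k x -> U k y -> exists l, geodesic geod k x y l.
  by move=> Ux Uy; have [l []] := geod_unique _ _ _ Ux Uy; exists l.
have overlap := @pconn_subgroupoid_overlap _ _ _ Gamma _ _ _
  geod_in geod_ex geod_compat flat.
apply/seteqP; split; first exact: overlap.
by rewrite setIC; exact: overlap.
Qed.
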